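(* Let $\varepsilon>0$. Assume that the mesh is such that for any $i\in\{1,\dots,M_h\}$ there exist $k\in\{M_h+1,\dots,N_h\}$ and $i_1,i_2,\dots,i_l\in\{1,\dots,M_h\}$ such that all these indices are mutually different and $$a_{ii_1}^D\ne0,\quad a_{i_1i_2}^D\ne0,\quad\dots,\quad a_{i_{l-1}i_l}^D\ne0,\quad a_{i_lk}^D\ne0.$$ Consider a finite element approximation $u_h=\sum_{j=1}^{N_h}u_j\varphi_j$ whose coefficients satisfy the nonlinear WMC problem $$a_i^Ru_i-\sum_{j\in\mathcal N_i\setminus\{i\}}\big[2d_{ij}(\bar u_{ij}^{s,*}-u_i)-a_{ij}^D(u_j-u_i)\big]=0\quad (i=1,\dots,M_h),\qquad u_i=u_D(\mathbf{x}_i)\quad (i=M_h+1,\dots,N_h).$$ Then $$f\ge0\ \text{in}\ \Omega\quad\text{and}\quad u_D\ge0\ \text{on}\ \Gamma_D\quad\Rightarrow\quad u_h\ge0\ \text{in}\ \Omega.$$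
   Context: **Problem data.** $d\in\{1,2,3\}$; $\Omega\subset\mathbb{R}^d$ is a bounded polytopal domain with Lipschitz boundary $\Gamma=\partial\Omega$. The continuous problem is $-\varepsilon\Delta u+\mathbf{v}\cdot\nabla u+cu=f$ in $\Omega$, $u=u_D$ on $\Gamma_D$, with constant $\varepsilon$, velocity field $\mathbf{v}:\overline\Omega\to\mathbb{R}^d$, $c\ge 0$, source $f$, and Dirichlet data $u_D$. For $\varepsilon>0$ one has $\Gamma_D=\Gamma$. The data $\mathbf{v},c,f$ (on $\overline\Omega$) and $u_D$ (on $\Gamma_D$) are continuous. **Mesh and finite elements.** $\mathcal T_h$ is a conforming simplex mesh with $\bigcup_{K\in\mathcal T_h}K=\overline\Omega$, vertices $\mathbf{x}_1,\dots,\mathbf{x}_{N_h}$, maximal cell diameter $h>0$. $\varphi_j\in C(\overline\Omega)$ are the piecewise linear Lagrange basis functions, $\varphi_j|_K\in\mathbb{P}_1(K)$ for all $K\in\mathcal T_h$, $\varphi_j(\mathbf{x}_i)=\delta_{ij}$. A vector $u=(u_1,\dots,u_{N_h})^\top$ is identified with $u_h=\sum_{j=1}^{N_h}u_j\varphi_j$. The vertices lying on the Dirichlet boundary are exactly those with indices $M_h+1,\dots,N_h$. $\mathcal N_i$ is the set of indices $j$ such that $\varphi_i,\varphi_j$ have overlapping supports, i.e. $\mathbf{x}_i,\mathbf{x}_j$ belong to a common mesh cell (so $i\in\mathcal N_i$). **Matrices.** $a_{ij}^D=\varepsilon\int_\Omega\nabla\varphi_i\cdot\nabla\varphi_j\,d\mathbf{x}$,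 $a_{ij}^C=\int_\Omega\varphi_i\,\mathbf{v}\cdot\nabla\varphi_j\,d\mathbf{x}$, $a_{ij}^R=\int_\Omega c\,\varphi_i\varphi_j\,d\mathbf{x}$, $b_i=\int_\Omega\varphi_i f\,d\mathbf{x}$, $a_i^R=\sum_{j\in\mathcal N_i}a_{ij}^R$. With a fixed constant $\delta>0$, for $j\in\mathcal N_i\setminus\{i\}$: $d_{ij}=\max\{|a_{ij}^C|,\delta h^{d-1},|a_{ji}^C|\}$ (and $d_{ij}=0$ if $j\notin\mathcal N_i$, $d_{ii}=-\sum_{k\in\mathcal N_i\setminus\{i\}}d_{ik}$); $a_i^C=\sum_{j\in\mathcal N_i\setminus\{i\}}2d_{ij}>0$. **Standing assumptions.** $a_{ij}^D\le 0$ for all $i\ne j$ in $\{1,\dots,N_h\}$; $|\mathbf{v}(\mathbf{x}_i)|+|\mathbf{v}(\mathbf{x}_j)|>0$ for all $i$ and $j\in\mathcal N_i\setminus\{i\}$ ($|\cdot|$ Euclidean norm). **Well-balanced (WMC) scheme.** All following quantities are functions of $u\in\mathbb{R}^{N_h}$. For $i=1,\dots,N_h$ and $j\in\mathcal N_i\setminus\{i\}$, with $s_i=f(\mathbf{x}_i)-c(\mathbf{x}_i)u_i$, $$\bar u_{ij}=\frac{u_j+u_i}{2}-\frac{a_{ij}^C(u_j-u_i)}{2d_{ij}},\qquad P_{ij}=\frac12\,\frac{s_i+s_j}{2}\,\frac{(\mathbf{x}_i-\mathbf{x}_j)\cdot(\mathbf{v}(\mathbf{x}_i)+\mathbf{v}(\mathbf{x}_j))}{2(\max\{|\mathbf{v}(\mathbf{x}_i)|,|\mathbf{v}(\mathbf{x}_j)|\})^2}.$$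 For $i\le M_h$, $j\in\mathcal N_i\setminus\{i\}$, fix a mesh cell $K_j^i$ containing $\mathbf{x}_i$ that is intersected by the half line $\{\mathbf{x}_i+\theta(\mathbf{x}_i-\mathbf{x}_j):\theta>0\}$, and set $u_j^i=u_i+\nabla u_h|_{K_j^i}\cdot(\mathbf{x}_i-\mathbf{x}_j)$. Define, for $i\le M_h$, $$Q_{ij}^+=\max\Big\{\tfrac{u_j^i-u_i}{2},\max\{u_i,u_j\}-\bar u_{ij}-\tfrac{b_i}{a_i^C}\Big\},\quad Q_{ij}^-=\min\Big\{\tfrac{u_j^i-u_i}{2},\min\{u_i,u_j\}-\bar u_{ij}-\tfrac{b_i}{a_i^C}\Big\},$$ $R_{ij}=Q_{ij}^+/P_{ij}$ if $b_i\le0$ and $P_{ij}>Q_{ij}^+$; $R_{ij}=Q_{ij}^-/P_{ij}$ if $b_i\ge0$ and $P_{ij}<Q_{ij}^-$; $R_{ij}=1$ otherwise. For $i>M_h$, $R_{ij}=1$. Set $\alpha_{ij}=\min\{R_{ij},R_{ji}\}$. For $i\le M_h$, $j\in\mathcal N_i\setminus\{i\}$: $$\bar u_{ij}^s=\bar u_{ij}+\alpha_{ij}P_{ij}+\frac{b_i}{a_i^C},\qquad f_{ij}^s=2d_{ij}\Big[\frac{u_i-u_j}{2}-\alpha_{ij}P_{ij}\Big]+a_{ij}^R(u_i-u_j),$$ $\bar u_i^{\min}=\min_{j\in\mathcal N_i\setminus\{i\}}\bar u_{ij}^s$, $\bar u_i^{\max}=\max_{j\in\mathcal N_i\setminus\{i\}}\bar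 u_{ij}^s$. The limited fluxes are: $f_{ij}^{s,*}=0$ if $f_{ij}^s=0$; if $i,j\le M_h$, $$f_{ij}^{s,*}=\begin{cases}\min\{f_{ij}^s,\,2d_{ij}(\bar u_i^{\max}-\bar u_{ij}^s),\,2d_{ij}(\bar u_{ji}^s-\bar u_j^{\min})\}& f_{ij}^s>0,\\ \max\{f_{ij}^s,\,2d_{ij}(\bar u_i^{\min}-\bar u_{ij}^s),\,2d_{ij}(\bar u_{ji}^s-\bar u_j^{\max})\}& f_{ij}^s<0,\end{cases}$$ and if $i\le M_h<j$, $$f_{ij}^{s,*}=\begin{cases}\min\{f_{ij}^s,\,2d_{ij}(\bar u_i^{\max}-\bar u_{ij}^s)\}& f_{ij}^s>0,\\ \max\{f_{ij}^s,\,2d_{ij}(\bar u_i^{\min}-\bar u_{ij}^s)\}& f_{ij}^s<0.\end{cases}$$ Finally $\bar u_{ij}^{s,*}=\bar u_{ij}^s+f_{ij}^{s,*}/(2d_{ij})$. *)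

(* Defs.v *)
From HB Require Import structures.
From mathcomp Require Import all_boot all_order all_algebra.
From mathcomp Require Import all_classical all_reals all_analysis.
Import Order.TTheory GRing.Theory Num.Theory.
Import numFieldNormedType.Exports.

Set Implicit Arguments.
Unset Strict Implicit.
Unset Printing Implicit Defensive.

Local Open Scope classical_set_scope.
Local Open Scope ring_scope.

(** Lebesgue measure on R^n, carried by [n.-tuple R] with its product
    sigma-algebra: the (n+1)-dimensional measure is the image of
    lebesgue_measure \x (n-dimensional measure) under (a, t) |-> a :: t. *)

Section LebesgueRn.
Context {R : realType}.
Notation T := (measurableTypeR R).

Definition tcons n (p : T * n.-tuple T) : n.+1.-tuple T := [tuple of p.1 :: p.2].

Lemma measurable_tcons n : measurable_fun setT (@tcons n).
Proof. exact: measurable_cons. Qed.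

Section step.
Variables (n : nat) (mu : {sigma_finite_measure set (n.-tuple T) -> \bar R}).

Definition leb_step : set (n.+1.-tuple T) -> \bar R :=
  pushforward (lebesgue_measure \x mu)%E (@tcons n).

Let leb_step0 : leb_step set0 = 0%E.
Proof. by rewrite /leb_step /pushforward preimage_set0 measure0. Qed.

Let leb_step_ge0 A : (0 <= leb_step A)%E.
Proof. by rewrite /leb_step /pushforward measure_ge0. Qed.

Let leb_step_sigma_additive : semi_sigma_additive leb_step.
Proof.
move=> F mF tF mUF; rewrite /leb_step /pushforward preimage_bigcup.
have mt A : measurable A -> measurable (@tcons n @^-1` A).
  by move=> mA; rewrite -[X in measurable X]setTI; exact: measurable_tcons.
apply: measure_semi_sigma_additive.
- by move=> k; exact: mt.
- apply/trivIsetP => /= i j _ _ ij; rewrite -preimage_setI.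
  by move/trivIsetP : tF => /(_ _ _ _ _ ij) ->//; rewrite preimage_set0.
- by rewrite -preimage_bigcup; exact: mt.
Qed.

HB.instance Definition _ := isMeasure.Build _ _ _ leb_step
  leb_step0 leb_step_ge0 leb_step_sigma_additive.

Let leb_step_sigma_finite : sigma_finite setT leb_step.
Proof.
have /sigma_finiteP[F [TF ndF Foo]] := sigma_finiteT (@lebesgue_measure R).
have /sigma_finiteP[G [TG ndG Goo]] := sigma_finiteT mu.
pose g (t : n.+1.-tuple T) : T * n.-tuple T := (thead t, [tuple of behead t]).
have gK : cancel (@tcons n) g.
  by move=> [a t]; rewrite /g /tcons/=; congr pair; exact/val_inj.
have mg : measurable_fun setT g.
  apply/measurable_fun_pair; first exact: (measurable_tnth ord0).
  exact: measurable_behead.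
exists (fun k => g @^-1` (F k `*` G k)).
  rewrite -preimage_bigcup; apply/esym; rewrite -subTset => t _ /=.
  have [k _ Fk] : (\bigcup_k F k) (g t).1 by rewrite -TF.
  have [l _ Gl] : (\bigcup_k G k) (g t).2 by rewrite -TG.
  exists (maxn k l) => //; split.
    by move: Fk; exact/subsetPset/ndF/leq_maxl.
  by move: Gl; exact/subsetPset/ndG/leq_maxr.
move=> k; have [? ?] := Foo k; have [? ?] := Goo k; split.
  by rewrite -[X in measurable X]setTI; apply: mg => //; exact: measurableX.
rewrite /leb_step /pushforward -comp_preimage (_ : g \o _ = id).
  by rewrite preimage_id product_measure1E// lte_mul_pinfty// ge0_fin_numE.
exact/funext.
Qed.

HB.instance Definition _ := Measure_isSigmaFinite.Build _ _ _ leb_step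
  leb_step_sigma_finite.

End step.

Fixpoint lebesgue_Rn n : {sigma_finite_measure set (n.-tuple T) -> \bar R} :=
  if n is k.+1 then leb_step (lebesgue_Rn k) else \d_([tuple] : 0.-tuple T).

End LebesgueRn.

Section Euclidean.
Context {R : realType} {d : nat}.
Notation E := 'rV[R]_d.

Definition dotv (a b : E) : R := \sum_k a ord0 k * b ord0 k.

(* The library norm on matrices is the max norm. *)
Definition enorm (a : E) : R := Num.sqrt (dotv a a).

Definition row_of_tuple (t : d.-tuple (measurableTypeR R)) : E :=
  \row_k (tnth t k : R).

Definition integral_on (D : set E) (g : E -> R) : R :=
  \int[lebesgue_Rn d]_(t in row_of_tuple @^-1` D) g (row_of_tuple t).

(* Partial derivatives that do not exist take the library's default value; for
   a piecewise affine g this only happens on the cell faces, a null set. *)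
Definition grad (g : E -> R) (y : E) : E :=
  \row_k 'D_(delta_mx ord0 k : E) (g : E -> R^o) y.

Definition diameter (A : set E) : R :=
  sup [set r | exists y z, [/\ A y, A z & r = enorm (y - z)]].

Definition hull (I : finType) (z : I -> E) (K : {set I}) : set E :=
  [set y | exists w : I -> R, [/\ forall i, 0 <= w i,
     \sum_(i in K) w i = 1 & y = \sum_(i in K) w i *: z i]].

Definition affinely_independent (I : finType) (z : I -> E) (K : {set I}) :=
  forall w : I -> R, \sum_(i in K) w i = 0 -> \sum_(i in K) w i *: z i = 0 ->
  forall i, i \in K -> w i = 0.

Definition boundary (D : set E) : set E := closure D `\` D°.

(* Near each boundary point, D is the strict epigraph, in some unit direction
   e, of a Lipschitz function of the component orthogonal to e. *)
Definition lipschitz_boundary (D : set E) :=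
  forall z, boundary D z -> exists (U : set E) (e : E) (gam : E -> R^o),
    [/\ nbhs z U, enorm e = 1, lipschitz gam &
        forall y, U y -> (D y <-> gam (y - dotv y e *: e) < dotv y e)].

Definition polytopal (D : set E) :=
  exists (n : nat) (z : 'I_n -> E) (F : {set {set 'I_n}}),
    closure D = \bigcup_(K in [set` F]) hull z K.

Definition bounded_polytopal_lipschitz_domain (D : set E) :=
  [/\ D !=set0, open D & connected D] /\
  [/\ bounded_set D, polytopal D & lipschitz_boundary D].

(* The gradient of a function that is affine on a nondegenerate simplex A, where
   the slope vector selected by [get] exists and is unique. *)
Definition gradient_on (A : set E) (g : E -> R) : E :=
  get [set q | forall y z, A y -> A z -> g y - g z = dotv q (y - z)].

End Euclidean.

(* Minimum and maximum of F over a nonempty finite A (0 if A is empty). *)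
Section MinMax.
Context {R : realType} {I : finType}.

Definition min_over (A : pred I) (F : I -> R) : R :=
  if [pick j | A j] is Some j0 then \big[Num.min/F j0]_(j | A j) F j else 0.

Definition max_over (A : pred I) (F : I -> R) : R :=
  if [pick j | A j] is Some j0 then \big[Num.max/F j0]_(j | A j) F j else 0.

End MinMax.

(* The source, velocity and reaction are only meaningful on the closure of
   [domain], the Dirichlet datum only on the Dirichlet boundary. *)
Record problem (R : realType) (d : nat) := Problem {
  domain : set 'rV[R]_d;
  diffusion : R;
  velocity : 'rV[R]_d -> 'rV[R]_d;
  reaction : 'rV[R]_d -> R;
  source : 'rV[R]_d -> R;
  dirichlet_datum : 'rV[R]_d -> R
}.

(* A cell is given by the set of indices of its vertices; vertices are indexed
   from 0, the non-Dirichlet ones by the indices i < nfree. *)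
Record mesh (R : realType) (d : nat) := Mesh {
  nvert : nat;
  nfree : nat;
  vertex : 'I_nvert -> 'rV[R]_d;
  cells : {set {set 'I_nvert}}
}.

Section Setting.
Context {R : realType} {d : nat}.
Notation E := 'rV[R]_d.

(* With positive diffusion the Dirichlet boundary is the whole boundary. *)
Definition dirichlet_boundary (p : problem R d) : set E := boundary (domain p).

Definition admissible_data (p : problem R d) :=
  [/\ {within closure (domain p), continuous (velocity p)},
      {within closure (domain p), continuous (reaction p : E -> R^o)},
      {within closure (domain p), continuous (source p : E -> R^o)},
      {within dirichlet_boundary p, continuous (dirichlet_datum p : E -> R^o)} &
      forall y, closure (domain p) y -> 0 <= reaction p y].

Definition cell_hull (m : mesh R d) (K : {set 'I_(nvert m)}) : set E :=
  hull (@vertex R d m) K.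

Definition mesh_size (m : mesh R d) : R :=
  \big[Num.max/0]_(K in cells m) diameter (cell_hull K).

Definition conforming_simplex_mesh (D : set E) (m : mesh R d) :=
  [/\ injective (@vertex R d m),
      forall K, K \in cells m ->
        #|K| = d.+1 /\ affinely_independent (@vertex R d m) K,
      forall i, exists2 K, K \in cells m & i \in K,
      (forall K L, K \in cells m -> L \in cells m ->
        cell_hull K `&` cell_hull L = cell_hull (K :&: L)) &
      \bigcup_(K in [set` cells m]) cell_hull K = closure D].

Definition dirichlet_numbering (p : problem R d) (m : mesh R d) :=
  (nfree m <= nvert m)%N /\
  forall i : 'I_(nvert m),
    dirichlet_boundary p (vertex i) <-> (nfree m <= i)%N.

Definition lagrange_basis (D : set E) (m : mesh R d)
    (phi : 'I_(nvert m) -> E -> R) :=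
  [/\ forall j, {within closure D, continuous (phi j : E -> R^o)},
      forall j K, K \in cells m -> exists (a : E) (b : R),
        forall y, cell_hull K y -> phi j y = dotv a y + b &
      forall i j, phi j (vertex i) = (i == j)%:R].

Definition neighbor (m : mesh R d) (i j : 'I_(nvert m)) : bool :=
  [exists K in cells m, (i \in K) && (j \in K)].

Definition neighbor' (m : mesh R d) (i j : 'I_(nvert m)) : bool :=
  neighbor i j && (j != i).

End Setting.

Section Scheme.
Context {R : realType} {d : nat} (p : problem R d) (m : mesh R d).
Notation E := 'rV[R]_d.
Notation idx := 'I_(nvert m).
Notation Omega := (domain p).
Context (phi : idx -> E -> R) (delta : R).

(* [far i j] is the cell at vertex i entered by the half line that starts at
   vertex i and points away from vertex j; [ufar] below extrapolates the
   finite element function from that cell to 2 x_i - x_j. *)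
Context (far : idx -> idx -> {set idx}).

Definition far_cells :=
  forall i j : idx, (i < nfree m)%N -> neighbor' i j ->
    [/\ far i j \in cells m, cell_hull (far i j) (vertex i) &
        exists2 theta : R, 0 < theta &
          cell_hull (far i j) (vertex i + theta *: (vertex i - vertex j))].

Definition aD (i j : idx) : R := diffusion p *
  integral_on Omega (fun y => dotv (grad (phi i) y) (grad (phi j) y)).

Definition aC (i j : idx) : R :=
  integral_on Omega (fun y => phi i y * dotv (velocity p y) (grad (phi j) y)).

Definition aR (i j : idx) : R :=
  integral_on Omega (fun y => reaction p y * phi i y * phi j y).

Definition bvec (i : idx) : R :=
  integral_on Omega (fun y => phi i y * source p y).

Definition aR_sum (i : idx) : R := \sum_(j | neighbor i j) aR i j.

Definition dmat_off (i j : idx) : R :=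
  if neighbor' i j then
    Num.max `|aC i j| (Num.max (delta * mesh_size m ^+ d.-1) `|aC j i|)
  else 0.

Definition dmat (i j : idx) : R :=
  if j == i then - \sum_(k | neighbor' i k) dmat_off i k else dmat_off i j.

Definition aC_sum (i : idx) : R := \sum_(j | neighbor' i j) 2 * dmat i j.

Section Coefficients.
Variable u : idx -> R.

Definition fe_function (y : E) : R := \sum_j u j * phi j y.

Definition ubar (i j : idx) : R :=
  (u j + u i) / 2 - aC i j * (u j - u i) / (2 * dmat i j).

Definition svec (i : idx) : R :=
  source p (vertex i) - reaction p (vertex i) * u i.

Definition Pflux (i j : idx) : R :=
  1 / 2 * ((svec i + svec j) / 2) *
  (dotv (vertex i - vertex j)
        (velocity p (vertex i) + velocity p (vertex j)) /
   (2 * (Num.max (enorm (velocity p (vertex i)))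
                 (enorm (velocity p (vertex j)))) ^+ 2)).

Definition ufar (i j : idx) : R :=
  u i + dotv (gradient_on (cell_hull (far i j)) fe_function)
             (vertex i - vertex j).

Definition Qplus (i j : idx) : R :=
  Num.max ((ufar i j - u i) / 2)
          (Num.max (u i) (u j) - ubar i j - bvec i / aC_sum i).

Definition Qminus (i j : idx) : R :=
  Num.min ((ufar i j - u i) / 2)
          (Num.min (u i) (u j) - ubar i j - bvec i / aC_sum i).

Definition Rfac (i j : idx) : R :=
  if (i < nfree m)%N then
    if (bvec i <= 0) && (Qplus i j < Pflux i j) then Qplus i j / Pflux i j
    else if (0 <= bvec i) && (Pflux i j < Qminus i j)
      then Qminus i j / Pflux i j
    else 1
  else 1.

Definition alpha (i j : idx) : R := Num.min (Rfac i j) (Rfac j i).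

Definition ubar_s (i j : idx) : R :=
  ubar i j + alpha i j * Pflux i j + bvec i / aC_sum i.

Definition flux_s (i j : idx) : R :=
  2 * dmat i j * ((u i - u j) / 2 - alpha i j * Pflux i j)
  + aR i j * (u i - u j).

Definition ubar_min (i : idx) : R := min_over (neighbor' i) (ubar_s i).
Definition ubar_max (i : idx) : R := max_over (neighbor' i) (ubar_s i).

(* Only used for i < nfree m. *)
Definition flux_lim (i j : idx) : R :=
  if flux_s i j == 0 then 0
  else if (j < nfree m)%N then
    if 0 < flux_s i j then
      Num.min (flux_s i j)
        (Num.min (2 * dmat i j * (ubar_max i - ubar_s i j))
                 (2 * dmat i j * (ubar_s j i - ubar_min j)))
    else
      Num.max (flux_s i j)
        (Num.max (2 * dmat i j * (ubar_min i - ubar_s i j))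
                 (2 * dmat i j * (ubar_s j i - ubar_max j)))
  else
    if 0 < flux_s i j then
      Num.min (flux_s i j) (2 * dmat i j * (ubar_max i - ubar_s i j))
    else
      Num.max (flux_s i j) (2 * dmat i j * (ubar_min i - ubar_s i j)).

Definition ubar_lim (i j : idx) : R :=
  ubar_s i j + flux_lim i j / (2 * dmat i j).

Definition wmc_solution :=
  (forall i : idx, (i < nfree m)%N ->
     aR_sum i * u i - \sum_(j | neighbor' i j)
       (2 * dmat i j * (ubar_lim i j - u i) - aD i j * (u j - u i)) = 0) /\
  (forall i : idx, (nfree m <= i)%N -> u i = dirichlet_datum p (vertex i)).

End Coefficients.

End Scheme.

(* Main.v *)
(** Suppose that [u] takes a negative minimum at vertex i;
    as the boundary data are nonnegative, i is not a Dirichlet vertex.  The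
    limiter of the source contribution [Pflux] keeps [ubar_s u i j >= u i]: the
    extrapolated value [ufar] is at least [u i] because the finite element
    function does not decrease from vertex i into the far cell, and [bvec >= 0].  The
    flux limiter then gives [ubar_lim >= ubar_min >= u i].  Hence all terms of
    the equation at i have one sign and vanish, and the negative minimum
    propagates to every j with [aD i j != 0]; along the path it reaches the
    Dirichlet boundary, a contradiction. *)
Require Import Defs.
From mathcomp Require Import all_boot all_order all_algebra.
From mathcomp Require Import all_classical all_reals all_analysis.
From mathcomp Require Import ring lra.
Import Order.TTheory GRing.Theory Num.Theory.
Import numFieldNormedType.Exports.
Local Open Scope classical_set_scope.
Local Open Scope ring_scope.

Set Implicit Arguments.
Unset Strict Implicit.

(** * Minima and maxima over finite index sets *)

Lemma min_over_le (R : realType) (I : finType) (A : pred I) (F : I -> R) j :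
  A j -> min_over A F <= F j.
Proof.
by move=> Aj; rewrite /min_over; case: pickP => [? _|/(_ j)/=];
  rewrite ?Aj// bigmin_le_cond.
Qed.

(** The witness [j] excludes the empty index set, where [min_over] is 0 by default. *)
Lemma le_min_over (R : realType) (I : finType) (A : pred I) (F : I -> R) j x :
  A j -> (forall i, A i -> x <= F i) -> x <= min_over A F.
Proof.
move=> Aj xF; rewrite /min_over; case: pickP => [j0 Aj0|/(_ j)/=]; rewrite ?Aj//.
by apply: le_bigmin => //; exact: xF.
Qed.

Lemma max_over_ge (R : realType) (I : finType) (A : pred I) (F : I -> R) j :
  A j -> F j <= max_over A F.
Proof.
by move=> Aj; rewrite /max_over; case: pickP => [? _|/(_ j)/=];
  rewrite ?Aj// le_bigmax_cond.
Qed.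

(** * Dot product identities and derivatives at a minimum *)

Lemma dotv_lincombr (R : realType) (d : nat) (I : finType) (a : 'rV[R]_d)
    (K : {set I}) (w : I -> R) (z : I -> 'rV[R]_d) :
  dotv a (\sum_(k in K) w k *: z k) = \sum_(k in K) w k * dotv a (z k).
Proof.
rewrite /dotv; under [RHS]eq_bigr do rewrite mulr_sumr.
rewrite exchange_big/=; apply: eq_bigr => l _; rewrite summxE mulr_sumr.
by apply: eq_bigr => k _; rewrite mxE; ring.
Qed.

Lemma dotvZr (R : realType) (d : nat) (c : R) (a b : 'rV[R]_d) :
  dotv a (c *: b) = c * dotv a b.
Proof. by rewrite /dotv mulr_sumr; apply: eq_bigr => k _; rewrite mxE; ring. Qed.

Lemma dotvDr (R : realType) (d : nat) (a b c : 'rV[R]_d) :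
  dotv a (b + c) = dotv a b + dotv a c.
Proof. by rewrite /dotv -big_split; apply: eq_bigr => k _; rewrite mxE mulrDr. Qed.

Lemma dotvNr (R : realType) (d : nat) (a b : 'rV[R]_d) :
  dotv a (- b) = - dotv a b.
Proof. by rewrite -scaleN1r dotvZr mulN1r. Qed.

Lemma dotv0l (R : realType) (d : nat) (a : 'rV[R]_d) : dotv 0 a = 0.
Proof. by rewrite /dotv big1// => k _; rewrite mxE mul0r. Qed.

Lemma dotv_suml (R : realType) (d : nat) (I : finType) (a : I -> 'rV[R]_d)
    (b : 'rV[R]_d) : dotv (\sum_i a i) b = \sum_i dotv (a i) b.
Proof.
rewrite /dotv exchange_big; apply: eq_bigr => k _.
by rewrite summxE mulr_suml.
Qed.

Lemma dotvC (R : realType) (d : nat) (a b : 'rV[R]_d) : dotv a b = dotv b a.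
Proof. by apply: eq_bigr => k _; rewrite mulrC. Qed.

(* The convention that a divergent limit is 0 makes differentiability
   unnecessary. *)
Lemma derive_local_min0 (R : realType) (d : nat) (g : 'rV[R]_d -> R^o) y v :
  (\forall z \near y, g y <= g z) -> 'D_v g y = 0 :> R^o.
Proof.
move=> gy_min; rewrite /derive.
set q := (fun h : R => _).
have [cq|/dvgP->//] := pselect (cvg (q h @[h --> 0^'])).
have hv0 : (h *: v + y) @[h --> 0 : R] --> y.
  rewrite -[X in _ --> X]add0r -[X in _ --> X + _](scale0r v).
  by apply: cvgD; [apply: cvgZr_tmp; exact: cvg_id|exact: cvg_cst].
have qn : \forall h \near (0 : R), g y <= g (h *: v + y).
  exact: hv0 _ gy_min.
have /nbhs_ballP[e e0 {}qn] := qn.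
(* The quotient [q] is nonpositive for small [h < 0] and nonnegative for small [h > 0], and both
   one-sided limits equal the derivative. *)
apply/eqP; rewrite eq_le; apply/andP; split.
  rewrite (cvg_at_leftE q)//; apply: limr_le.
    rewrite -(cvg_at_leftE q)//; apply: cvg_trans cq; apply: cvg_app.
    by move=> A [r r0 Ar]; exists r => // x xr /ltr0_neq0; exact: Ar.
  exists e => // h he h0; rewrite /q/= mulr_le0_ge0 ?invr_le0 ?(ltW h0)//.
  by rewrite subr_ge0; exact: qn.
rewrite (cvg_at_rightE q)//; apply: limr_ge.
  rewrite -(cvg_at_rightE q)//; apply: cvg_trans cq; apply: cvg_app.
  by move=> A [r r0 Ar]; exists r => // x xr /lt0r_neq0; exact: Ar.
exists e => // h he h0; rewrite /q/= mulr_ge0 ?invr_ge0 ?(ltW h0)//.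
by rewrite subr_ge0; exact: qn.
Qed.

(** * Integrals, convex hulls and vertex adjacency *)

Lemma integral_on_ge0 (R : realType) (d : nat) (D : set 'rV[R]_d) g :
  (forall y, D y -> 0 <= g y) -> 0 <= integral_on D g.
Proof. by move=> g0; apply: Rintegral_ge0 => t; exact: g0. Qed.

Lemma integral_on_eq0 (R : realType) (d : nat) (D : set 'rV[R]_d) g :
  (forall y, D y -> g y = 0) -> integral_on D g = 0.
Proof.
move=> g0; rewrite /integral_on (@eq_Rintegral _ _ _ _ _ (fun=> 0)).
  by rewrite /Rintegral integral0.
by move=> t; rewrite inE; exact: g0.
Qed.

Lemma hull_vertex (R : realType) (d : nat) (I : finType) (z : I -> 'rV[R]_d)
    (K : {set I}) k : k \in K -> hull z K (z k).
Proof.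
move=> kK; exists (fun l => (l == k)%:R); split=> [l||]; first exact: ler0n.
  by rewrite (bigD1 k)//= eqxx big1 ?addr0// => l /andP[_ /negbTE->].
rewrite (bigD1 k)//= eqxx scale1r big1 ?addr0// => l /andP[_ /negbTE->].
by rewrite scale0r.
Qed.

Lemma neighborC (R : realType) (d : nat) (m : mesh R d) (i j : 'I_(nvert m)) :
  neighbor i j = neighbor j i.
Proof. by apply: eq_existsb => K; rewrite [(i \in K) && _]andbC. Qed.

Lemma neighbor'C (R : realType) (d : nat) (m : mesh R d) (i j : 'I_(nvert m)) :
  neighbor' i j = neighbor' j i.
Proof. by rewrite /neighbor' neighborC eq_sym. Qed.

(** * Lagrange basis functions and finite element functions on cells *)

Section LagrangeBasis.
Context (R : realType) (d : nat) (D : set 'rV[R]_d) (m : mesh R d).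
Context (phi : 'I_(nvert m) -> 'rV[R]_d -> R).
Hypotheses (hmesh : conforming_simplex_mesh D m) (hphi : lagrange_basis D phi).

(** An affine function preserves convex combinations, so the nodal values of [phi j] single out one
    barycentric coordinate. *)
Lemma lagrange_barycentric (K : {set 'I_(nvert m)}) (w : 'I_(nvert m) -> R) j :
  K \in cells m -> (forall i, 0 <= w i) -> \sum_(i in K) w i = 1 ->
  phi j (\sum_(i in K) w i *: vertex i) = if j \in K then w j else 0.
Proof.
case: hphi => _ haff hnode Kc w0 w1; have [a [b hab]] := haff j K Kc.
rewrite hab; last by exists w.
(* The weights sum to 1, so the constant [b] can be spread over them; each summand becomes [w k]
   times a nodal value. *)
rewrite dotv_lincombr -[b]mul1r -w1 mulr_suml -big_split/=.
rewrite (eq_bigr (fun k => w k * (k == j)%:R)); last first.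
  move=> k kK; rewrite -hnode hab ?mulrDr//; exact: hull_vertex.
case: ifPn => jK.
  rewrite (bigD1 j)//= eqxx mulr1 big1 ?addr0// => k /andP[_ /negbTE->].
  by rewrite mulr0.
rewrite big1// => k kK; case: eqP => [kj|_]; last by rewrite mulr0.
by rewrite -kj kK in jK.
Qed.

Lemma fe_function_barycentric u (K : {set 'I_(nvert m)}) (w : 'I_(nvert m) -> R) :
  K \in cells m -> (forall i, 0 <= w i) -> \sum_(i in K) w i = 1 ->
  fe_function phi u (\sum_(i in K) w i *: vertex i) = \sum_(i in K) w i * u i.
Proof.
move=> Kc w0 w1; rewrite /fe_function.
under eq_bigr do rewrite lagrange_barycentric//.
rewrite [RHS]big_mkcond; apply: eq_bigr => i _.
by case: ifP; rewrite ?mulr0// mulrC.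
Qed.

Lemma fe_function_vertex u i : fe_function phi u (vertex i) = u i.
Proof.
case: hphi => _ _ hnode; rewrite /fe_function (bigD1 i)//= hnode eqxx mulr1.
by rewrite big1 ?addr0// => j; rewrite hnode eq_sym => /negbTE->; rewrite mulr0.
Qed.

Lemma fe_function_ge u c (K : {set 'I_(nvert m)}) y : K \in cells m ->
  (forall i, c <= u i) -> cell_hull K y -> c <= fe_function phi u y.
Proof.
move=> Kc cu [w [w0 w1 ->]]; rewrite fe_function_barycentric//.
by rewrite -[c]mul1r -w1 mulr_suml; apply: ler_sum => i _; exact: ler_wpM2l.
Qed.

Lemma closure_cell y : closure D y ->
  exists2 K, K \in cells m & cell_hull K y.
Proof. by case: hmesh => _ _ _ _ <- -[K Kc Ky]; exists K. Qed.

Lemma lagrange_ge0 j y : closure D y -> 0 <= phi j y.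
Proof.
move=> /closure_cell[K Kc [w [w0 w1 ->]]].
by rewrite lagrange_barycentric//; case: ifP.
Qed.

(** On a cell containing [y], only the basis functions of its own vertices can be nonzero. *)
Lemma lagrange_support_neighbor i j y : closure D y ->
  phi i y != 0 -> phi j y != 0 -> neighbor i j.
Proof.
move=> /closure_cell[K Kc [w [w0 w1 ->]]]; rewrite !lagrange_barycentric//.
case: ifP => [iK _|]; last by rewrite eqxx.
case: ifP => [jK _|]; last by rewrite eqxx.
by apply/existsP; exists K; rewrite Kc iK.
Qed.

(* A zero of a nonnegative function is a minimum, so the gradient vanishes there
   even on cell faces. *)
Lemma grad_lagrange0 j y : open D -> D y -> phi j y = 0 -> grad (phi j) y = 0.
Proof.
move=> oD Dy phi0; apply/rowP => k; rewrite !mxE; apply: derive_local_min0.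
rewrite phi0; apply: filterS (open_nbhs_nbhs (conj oD Dy)) => z Dz.
exact/lagrange_ge0/subset_closure.
Qed.

Lemma gradient_on_fe_function u K y z : K \in cells m ->
  cell_hull K y -> cell_hull K z ->
  fe_function phi u y - fe_function phi u z =
  dotv (gradient_on (cell_hull K) (fe_function phi u)) (y - z).
Proof.
move=> Kc Ky Kz; rewrite /gradient_on.
set S := [set q | _]; suff : S !=set0 by move=> /getPex; exact.
case: hphi => _ haff _.
have /choice[a ha] : forall j, exists a, exists b,
    forall y, cell_hull K y -> phi j y = dotv a y + b.
  by move=> j; exact: haff.
(* The slopes [a j] of the basis functions on the cell combine to a slope of the finite element
   function, so [get] returns a genuine slope. *)
exists (\sum_j u j *: a j) => y' z' Ky' Kz'.
rewrite /fe_function -sumrB dotv_suml; apply: eq_bigr => j _.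
have [b hb] := ha j; rewrite !hb// [dotv (_ *: _) _]dotvC dotvZr.
by rewrite [dotv (_ - _) _]dotvC dotvDr dotvNr; ring.
Qed.

End LagrangeBasis.

(** * Signs of the load vector and the matrices, and bounds on [ubar] *)

Section Scheme.
Context (R : realType) (d : nat) (p : problem R d) (m : mesh R d).
Context (phi : 'I_(nvert m) -> 'rV[R]_d -> R) (delta : R).
Context (far : 'I_(nvert m) -> 'I_(nvert m) -> {set 'I_(nvert m)}).
Context (u : 'I_(nvert m) -> R).
Hypotheses (hmesh : conforming_simplex_mesh (domain p) m).
Hypotheses (hphi : lagrange_basis (domain p) phi).
Hypothesis source_ge0 : forall y, domain p y -> 0 <= source p y.

Lemma bvec_ge0 i : 0 <= bvec p phi i.
Proof.
apply: integral_on_ge0 => y Dy; apply: mulr_ge0; last exact: source_ge0.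
by apply: (lagrange_ge0 hmesh hphi); exact: subset_closure.
Qed.

Lemma aR_sum_ge0 i : (forall y, closure (domain p) y -> 0 <= reaction p y) ->
  0 <= aR_sum p phi i.
Proof.
move=> c0; apply: sumr_ge0 => j _; apply: integral_on_ge0 => y Dy.
have cDy : closure (domain p) y by exact: subset_closure.
by rewrite !mulr_ge0 ?c0// (lagrange_ge0 hmesh hphi).
Qed.

(** At each point of the domain one of the two basis functions vanishes, and its gradient with it,
    so the integrand is zero everywhere. *)
Lemma aD_not_neighbor i j : open (domain p) -> ~~ neighbor i j ->
  aD p phi i j = 0.
Proof.
move=> oD nij; rewrite /aD integral_on_eq0 ?mulr0// => y Dy.
have [phii0|phii0] := eqVneq (phi i y) 0.
  by rewrite (grad_lagrange0 hmesh hphi)// dotv0l.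
have [phij0|phij0] := eqVneq (phi j y) 0.
  by rewrite dotvC (grad_lagrange0 hmesh hphi)// dotv0l.
by rewrite (lagrange_support_neighbor hmesh hphi (subset_closure Dy) phii0) in nij.
Qed.

Lemma normr_aC_le_dmat i j : neighbor' i j ->
  `|aC p phi i j| <= dmat p phi delta i j.
Proof.
move=> nij; have /andP[_ /negbTE ji] := nij.
by rewrite /dmat ji /dmat_off nij le_max lexx.
Qed.

Lemma dmat_ge0 i j : neighbor' i j -> 0 <= dmat p phi delta i j.
Proof. by move/normr_aC_le_dmat; exact: le_trans. Qed.

Lemma bvec_aC_sum_ge0 i : 0 <= bvec p phi i / aC_sum p phi delta i.
Proof.
rewrite divr_ge0 ?bvec_ge0// sumr_ge0// => j nij.
by rewrite mulr_ge0// dmat_ge0.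
Qed.

(* Where [dmat] vanishes, the convention [x / 0 = 0] makes [ubar] the mean. *)
Lemma ubar_between i j : neighbor' i j ->
  Num.min (u i) (u j) <= ubar p phi delta u i j <= Num.max (u i) (u j).
Proof.
move=> nij; have := normr_aC_le_dmat nij; rewrite /ubar.
set a := aC _ _ _ _; set e := dmat _ _ _ _ _ => ae.
have e0 : 0 <= e by exact: dmat_ge0.
have : `|a / (2 * e)| <= 1 / 2.
  have [->|en0] := eqVneq e 0; first by rewrite mulr0 invr0 mulr0 normr0.
  have {e0}ep : 0 < e by rewrite lt_neqAle eq_sym en0.
  rewrite normrM normfV (gtr0_norm (_ : 0 < 2 * e)) ?mulr_gt0//.
  by rewrite ler_pdivrMr ?mulr_gt0//; lra.
(* [ubar] is the convex combination of [u j] and [u i] with weights [1 / 2 - t] and [1 / 2 + t]. *)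
rewrite mulrAC; set t := a / (2 * e); rewrite ler_norml => /andP[t1 t2].
by case: (leP (u i) (u j)) => uij; apply/andP; split; nra.
Qed.

(** * Lower bounds from the source limiter and the flux limiter *)

Lemma Qminus_le0 i j : neighbor' i j -> Qminus p phi delta far u i j <= 0.
Proof.
move=> nij; have /andP[+ _] := ubar_between nij; have := bvec_aC_sum_ge0 i.
by move=> ? ?; rewrite /Qminus ge_min; apply/orP; right; lra.
Qed.

(** As the source is nonnegative, the sign condition forces [bvec i = 0]; the second entry of the
    maximum is then nonnegative because [ubar] is at most the larger value. *)
Lemma Qplus_ge0 i j : neighbor' i j -> bvec p phi i <= 0 ->
  0 <= Qplus p phi delta far u i j.
Proof.
move=> nij bi0; have /andP[_] := ubar_between nij.
have biz : bvec p phi i = 0 by apply/eqP; rewrite eq_le bi0 bvec_ge0.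
by move=> ?; rewrite /Qplus le_max biz mul0r; apply/orP; right; lra.
Qed.

Lemma Rfac_ge0 i j : neighbor' i j -> 0 <= Rfac p phi delta far u i j.
Proof.
move=> nij; rewrite /Rfac; case: ifP => // _; case: ifP => [/andP[bi QP]|_].
  by have Q0 := Qplus_ge0 nij bi; rewrite divr_ge0// (le_trans Q0) ?ltW.
case: ifP => // /andP[bi PQ]; have Q0 := Qminus_le0 nij.
by rewrite mulr_le0// invr_le0 (le_trans _ Q0) ?ltW.
Qed.

(** For [Pflux >= 0] the signs suffice. For [Pflux < 0], [alpha <= Rfac i j] reduces the bound to
    [Rfac i j * Pflux], which is [Qminus] if the limiter acts and [Pflux >= Qminus] otherwise. *)
Lemma Qminus_le_alphaP (i j : 'I_(nvert m)) : (i < nfree m)%N -> neighbor' i j ->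
  Qminus p phi delta far u i j <=
  alpha p phi delta far u i j * Pflux p u i j.
Proof.
move=> ifree nij; have Q0 := Qminus_le0 nij.
have nji : neighbor' j i by rewrite neighbor'C.
have alpha0 : 0 <= alpha p phi delta far u i j.
  by rewrite /alpha le_min !Rfac_ge0.
have [P0|P0] := leP 0 (Pflux p u i j); first by rewrite (le_trans Q0)// mulr_ge0.
apply: (@le_trans _ _ (Rfac p phi delta far u i j * Pflux p u i j)); last first.
  by rewrite ler_wnM2r ?(ltW P0)// /alpha ge_min lexx.
(* Limiting by [Qplus] cannot occur here, since [0 <= Qplus < Pflux] contradicts [Pflux < 0]. *)
rewrite /Rfac ifree bvec_ge0/=; case: ifP => [/andP[bi QP]|_].
  by have := lt_le_trans QP (ltW P0); rewrite ltNge Qplus_ge0.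
by case: ltP => [PQ|]; rewrite ?mul1r// divfK ?lt_eqF.
Qed.

(** The increment from vertex [i] to the point of the half line in the far cell is [theta] times the
    increment defining [ufar]; it is nonnegative by minimality of [u i]. *)
Lemma ufar_ge (i j : 'I_(nvert m)) :
  far_cells far -> (i < nfree m)%N -> neighbor' i j ->
  (forall k, u i <= u k) -> u i <= ufar phi far u i j.
Proof.
move=> hfar ifree nij uimin.
have [Kc Ki [theta theta0 Kfar]] := hfar _ _ ifree nij.
have := fe_function_ge hphi Kc uimin Kfar.
rewrite -subr_ge0 -{1}(fe_function_vertex hphi u i).
rewrite (gradient_on_fe_function hphi u Kc Kfar Ki) addrAC subrr add0r dotvZr.
by rewrite pmulr_rge0// /ufar lerDl.
Qed.

Lemma ubar_s_ge (i j : 'I_(nvert m)) :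
  far_cells far -> (i < nfree m)%N -> neighbor' i j ->
  (forall k, u i <= u k) -> u i <= ubar_s p phi delta far u i j.
Proof.
move=> hfar ifree nij uimin; have := Qminus_le_alphaP ifree nij.
have := ufar_ge hfar ifree nij uimin; have /andP[+ _] := ubar_between nij.
have := bvec_aC_sum_ge0 i.
rewrite /ubar_s /Qminus (min_l (uimin j)) => b0 ubar0 ufar0.
(* The extrapolation entry of [Qminus] is nonnegative and the other one nonpositive, so [Qminus] is
   the latter, and adding [ubar] and the source term to it gives exactly [u i]. *)
rewrite min_r; lra.
Qed.

(** A positive flux is limited by nonnegative bounds, so it cannot lower [ubar_s]; a negative one is
    cut off where [ubar_lim] would fall below [ubar_min]. *)
Lemma ubar_min_le_lim i j : neighbor' i j ->
  ubar_min p phi delta far u i <= ubar_lim p phi delta far u i j.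
Proof.
move=> nij; have nji : neighbor' j i by rewrite neighbor'C.
have d0 := dmat_ge0 nij.
have min_i : ubar_min p phi delta far u i <= ubar_s p phi delta far u i j.
  exact: min_over_le.
have max_i : ubar_s p phi delta far u i j <= ubar_max p phi delta far u i.
  exact: max_over_ge.
have min_j : ubar_min p phi delta far u j <= ubar_s p phi delta far u j i.
  exact: min_over_le.
rewrite /ubar_lim /flux_lim; move: d0 min_i max_i min_j.
move: (dmat _ _ _ i j) (flux_s _ _ _ _ _ i j).
move: (ubar_min _ _ _ _ _ i) (ubar_max _ _ _ _ _ i) (ubar_s _ _ _ _ _ i j).
move: (ubar_min _ _ _ _ _ j) (ubar_max _ _ _ _ _ j) (ubar_s _ _ _ _ _ j i).
move=> mj Mj sj mi Mi si e f d0 min_i max_i min_j.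
(* For [e = 0] the convention [x / 0 = 0] removes the flux correction. *)
have [->|en0] := eqVneq e 0; first by rewrite mulr0 invr0 mulr0 addr0.
have ep : 0 < 2 * e by rewrite mulr_gt0// lt_neqAle eq_sym en0.
rewrite -lerBlDl ler_pdivlMr// mulrC.
have le0 : 2 * e * (mi - si) <= 0 by rewrite mulr_ge0_le0 ?(ltW ep) ?subr_le0.
case: ifP => // _; case: ifP => _; case: ifP => [f0|_].
- apply: (le_trans le0); rewrite !le_min (ltW f0)/=.
  by rewrite !mulr_ge0 ?(ltW ep) ?subr_ge0.
- by rewrite !le_max lexx orbT.
- apply: (le_trans le0); rewrite le_min (ltW f0)/=.
  by rewrite mulr_ge0 ?(ltW ep) ?subr_ge0.
- by rewrite le_max lexx orbT.
Qed.

(* At a negative minimum every term of the discrete equation has the same sign,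
   hence all of them vanish. *)
Lemma min_propagates (i j : 'I_(nvert m)) : open (domain p) ->
  (forall y, closure (domain p) y -> 0 <= reaction p y) ->
  (forall k l, k != l -> aD p phi k l <= 0) -> far_cells far ->
  wmc_solution p phi delta far u -> (i < nfree m)%N ->
  (forall k, u i <= u k) -> u i < 0 -> j != i -> aD p phi i j != 0 ->
  u j = u i.
Proof.
move=> oD c0 haD hfar [hu _] ifree uimin ui0 ji aij.
have nij : neighbor' i j.
  by rewrite /neighbor' ji andbT; apply: contraNT aij => /aD_not_neighbor->.
have lim_ge k : neighbor' i k -> u i <= ubar_lim p phi delta far u i k.
  move=> nik; apply: le_trans (ubar_min_le_lim nik).
  by apply: le_min_over nik _ => l nil; exact: ubar_s_ge.
have term_ge0 k : neighbor' i k ->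
    0 <= 2 * dmat p phi delta i k * (ubar_lim p phi delta far u i k - u i)
         - aD p phi i k * (u k - u i).
  move=> nik; have /andP[_ ki] := nik.
  rewrite addr_ge0//; last first.
    by rewrite oppr_ge0 mulr_le0_ge0 ?haD ?subr_ge0// eq_sym.
  by rewrite mulr_ge0 ?mulr_ge0 ?dmat_ge0// subr_ge0 lim_ge.
have := hu i ifree; move/eqP; rewrite subr_eq0 => /eqP heq.
have /eqP : \sum_(k | neighbor' i k)
    (2 * dmat p phi delta i k * (ubar_lim p phi delta far u i k - u i)
     - aD p phi i k * (u k - u i)) = 0.
  (* The equation makes this sum of nonnegative terms equal to [aR_sum i * u i], which is
     nonpositive because [u i < 0]. *)
  apply/eqP; rewrite eq_le sumr_ge0// andbT -heq mulr_ge0_le0 ?(ltW ui0)//.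
  exact: aR_sum_ge0.
rewrite psumr_eq0// => /allP/(_ j (mem_index_enum j)); rewrite nij/= => /eqP term0.
(* Both parts of the vanishing term are nonnegative, so the diffusive part is zero, and [aD i j < 0]
   forces [u j = u i]. *)
have := lim_ge j nij; rewrite -subr_ge0.
move/(mulr_ge0 (mulr_ge0 (ler0n R 2) (dmat_ge0 nij))).
have aijN : aD p phi i j < 0 by rewrite lt_neqAle aij haD// eq_sym.
have := uimin j; nra.
Qed.

End Scheme.

(** * Propagation of a negative minimum to the Dirichlet boundary *)

Unset Implicit Arguments.
Set Strict Implicit.

Theorem corollary1 (R : realType) (d : nat) (p : problem R d) (m : mesh R d)
  (phi : 'I_(nvert m) -> 'rV[R]_d -> R) (delta : R)
  (far : 'I_(nvert m) -> 'I_(nvert m) -> {set 'I_(nvert m)})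
  (u : 'I_(nvert m) -> R)
  (hd : (1 <= d <= 3)%N)
  (hdomain : bounded_polytopal_lipschitz_domain (domain p))
  (hdata : admissible_data p)
  (hmesh : conforming_simplex_mesh (domain p) m)
  (hnumbering : dirichlet_numbering p m)
  (hphi : lagrange_basis (domain p) phi)
  (hdelta : 0 < delta)
  (hfar : far_cells far)
  (haD : forall i j : 'I_(nvert m), i != j -> aD p phi i j <= 0)
  (hvel : forall i j : 'I_(nvert m), neighbor' i j ->
    0 < enorm (velocity p (vertex i)) + enorm (velocity p (vertex j)))
  (heps : 0 < diffusion p)
  (hpath : forall i : 'I_(nvert m), (i < nfree m)%N ->
    exists (k : 'I_(nvert m)) (s : seq 'I_(nvert m)),
      [/\ (nfree m <= k)%N,
          all (fun j : 'I_(nvert m) => (j < nfree m)%N) s,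
          uniq (i :: rcons s k) &
          path (fun j l => aD p phi j l != 0) i (rcons s k)])
  (hu : wmc_solution p phi delta far u) :
  (forall y, domain p y -> 0 <= source p y) ->
  (forall y, dirichlet_boundary p y -> 0 <= dirichlet_datum p y) ->
  forall y, domain p y -> 0 <= fe_function phi u y.
Proof.
move=> source_ge0 datum_ge0.
have [[_ oD _] _] := hdomain; have [_ _ _ _ c_ge0] := hdata.
have [_ hdir] := hnumbering; have [_ u_dir] := hu.
have u_ge0_dir (i : 'I_(nvert m)) : (nfree m <= i)%N -> 0 <= u i.
  by move=> idir; rewrite u_dir// datum_ge0//; exact/hdir.
have u_ge0 i0 : 0 <= u i0.
  case: (@arg_minP _ _ _ i0 xpredT u isT) => i _ uimin.
  apply: le_trans (uimin i0 isT); rewrite leNgt; apply/negP => ui0.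
  have free (j : 'I_(nvert m)) : u j = u i -> (j < nfree m)%N.
    move=> uj; rewrite ltnNge; apply/negP => /u_ge0_dir.
    by rewrite uj leNgt ui0.
  (* Each vertex reached carries the minimum, hence is free, and the next step applies; [uniq] makes
     consecutive vertices distinct. *)
  have min_along_path s j : u j = u i -> uniq (j :: s) ->
      path (fun j l => aD p phi j l != 0) j s -> u (last j s) = u i.
    elim: s j => //= l s IHs j uj /andP[jls uls] /andP[ajl pls].
    apply: IHs => //; rewrite -uj; move: jls; rewrite inE negb_or => /andP[jl _].
    apply: (min_propagates hmesh hphi source_ge0 oD c_ge0 haD hfar hu) => //.
    - exact: free.
    - by move=> k; rewrite uj uimin.
    - by rewrite uj.
    - by rewrite eq_sym.
  have [k [s [kdir _ us ps]]] := hpath i (free i erefl).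
  have := min_along_path _ i erefl us ps; rewrite last_rcons => /free.
  by rewrite ltnNge kdir.
move=> y Dy; have [K Kc Ky] := closure_cell hmesh (@subset_closure _ _ y Dy).
exact: (fe_function_ge hphi Kc u_ge0 Ky).
Qed.
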